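(* Let $\mathbb F_2$ denote the free group on two generators. Then there exist finitely generated subgroups of $\mathbb F_2\times\mathbb F_2$ that do not have bounded packing in $\mathbb F_2\times\mathbb F_2$.
   Context: Bounded packing: let $G$ be a countable group with a proper, left-invariant metric $d$ (proper means that balls of finite radius are finite), and let $H\leq G$. For subsets $S,T\subset G$ put $d(S,T)=\inf\{d(s,t): s\in S,\ t\in T\}$. The subgroup $H$ has bounded packing in $G$ if for every $D>0$ there is a number $n=n(G,H,D)$ such that every collection $I\subset G/H$ of left cosets of $H$ with $d(g_1H,g_2H)\leq D$ for all $g_1H,g_2H\in I$ satisfies $|I|\leq n$. This property does not depend on the choice of the proper left-invariant metric $d$; every countable group admits such a metric, e.g. a word metric if the group is finitely generated. *)

(* Defs.v *)
From HB Require Import structures.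
From mathcomp Require Import all_boot all_order all_algebra.
From mathcomp Require Import all_classical all_reals.
Set Implicit Arguments.
Unset Strict Implicit.
Unset Printing Implicit Defensive.
Import Order.TTheory GRing.Theory Num.Theory.

Local Open Scope classical_set_scope.

Section FreeGroup.
Variable T : choiceType.

(* The letter (t, false) stands for the generator t, (t, true) for t^-1. *)
Definition letter := (T * bool)%type.
Implicit Types (l m : letter) (u v w : seq letter).

Definition letter_inv l : letter := (l.1, ~~ l.2).

Definition reduced w := sorted (fun l m => m != letter_inv l) w.

Record free_group := FreeGroup { word :> seq letter; _ : reduced word }.

HB.instance Definition _ := [isSub for word].
HB.instance Definition _ := [Choice of free_group by <:].

Definition push l w :=
  if w is m :: w' then if m == letter_inv l then w' else l :: w else [:: l].

(* For reduced v, this is the reduced form of the concatenation u ++ v. *)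
Definition word_mul u v := foldr push v u.

Definition word_inv u := rev (map letter_inv u).

Lemma letter_invK : involutive letter_inv.
Proof. by case=> t b; rewrite /letter_inv /= negbK. Qed.

Lemma push_reduced l w : reduced w -> reduced (push l w).
Proof.
case: w => [//|m w] /= mw; case: eqP => [_|/eqP ml].
  exact: path_sorted mw.
by rewrite /reduced /= ml.
Qed.

Lemma word_mul_reduced u v : reduced v -> reduced (word_mul u v).
Proof. by move=> rv; elim: u => //= l u; exact: push_reduced. Qed.

Lemma word_inv_reduced u : reduced u -> reduced (word_inv u).
Proof.
rewrite /reduced /word_inv rev_sorted sorted_map.
apply: sub_sorted => l m /=; apply: contra => /eqP ->.
by rewrite letter_invK.
Qed.

Lemma pushK l w : reduced w -> push l (push (letter_inv l) w) = w.
Proof.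
case: w => [|m w] /=; first by rewrite eqxx.
rewrite letter_invK => mw; case: eqP => [ml|_] /=; last by rewrite eqxx.
case: w mw => [|p w] /=; first by rewrite ml.
by rewrite -ml => /andP[/negPf ->].
Qed.

Lemma word_mul_push l v w : reduced w ->
  word_mul (push l v) w = push l (word_mul v w).
Proof.
move=> rw; case: v => [//|m v] /=; case: eqP => [->|_ //].
by rewrite pushK // word_mul_reduced.
Qed.

Lemma word_mulA u v w : reduced w ->
  word_mul u (word_mul v w) = word_mul (word_mul u v) w.
Proof. by move=> rw; elim: u => //= l u ->; rewrite word_mul_push. Qed.

Lemma word_mul0 u : reduced u -> word_mul u [::] = u.
Proof.
elim: u => //= l u IH lu; rewrite IH; last exact: path_sorted lu.
by case: u lu {IH} => //= m u /andP[/negPf ->].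
Qed.

Lemma word_mulV u : word_mul (word_inv u) u = [::].
Proof.
elim: u => // l u IH.
rewrite /word_inv /= rev_cons /word_mul -cats1 foldr_cat /=.
by rewrite letter_invK eqxx.
Qed.

Lemma word_invK : involutive word_inv.
Proof.
move=> u; rewrite /word_inv map_rev revK -map_comp map_id_in // => l _.
exact: letter_invK.
Qed.

Definition fg_one := @FreeGroup [::] isT.
Definition fg_mul (x y : free_group) :=
  FreeGroup (word_mul_reduced x (valP y)).
Definition fg_inv (x : free_group) := FreeGroup (word_inv_reduced (valP x)).

Fact fg_mulA : associative fg_mul.
Proof. by move=> x y z; apply/val_inj/word_mulA/valP. Qed.
Fact fg_mul1 : left_id fg_one fg_mul.
Proof. by move=> x; exact: val_inj. Qed.
Fact fg_mulr1 : right_id fg_one fg_mul.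
Proof. by move=> x; apply/val_inj/word_mul0/valP. Qed.
Fact fg_mulV : left_inverse fg_one fg_inv fg_mul.
Proof. by move=> x; apply/val_inj/word_mulV. Qed.
Fact fg_mulrV : right_inverse fg_one fg_inv fg_mul.
Proof.
by move=> x; apply: val_inj; rewrite /= -{1}[word x]word_invK word_mulV.
Qed.

HB.instance Definition _ :=
  isGroup.Build free_group fg_mulA fg_mul1 fg_mulr1 fg_mulV fg_mulrV.

Definition fg_gen (t : T) : free_group := @FreeGroup [:: (t, false)] isT.

(* The universal property: free_group is free on the generators fg_gen t. *)
Section Universal.
Local Open Scope group_scope.
Variables (G : groupType) (f : T -> G).

Definition letter_val l := if l.2 then (f l.1)^-1 else f l.1.
Definition fg_lift (x : free_group) : G := \prod_(l <- word x) letter_val l.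

Lemma letter_valV l : letter_val (letter_inv l) = (letter_val l)^-1.
Proof. by case: l => t [] //=; rewrite /letter_val /= invgK. Qed.

Lemma fg_lift_gen t : fg_lift (fg_gen t) = f t.
Proof. by rewrite /fg_lift /= big_seq1. Qed.

Lemma fg_liftM : {morph fg_lift : x y / x * y}.
Proof.
move=> x y; rewrite /fg_lift [word (x * y)]/=.
elim: (word x) => [|l u IH] /=; first by rewrite big_nil mul1g.
rewrite big_cons -mulgA -IH; case: (word_mul u y) => [|m w] /=.
  by rewrite big_cons.
case: eqP => [->|_]; last by rewrite !big_cons.
by rewrite big_cons letter_valV mulgA mulgV mul1g.
Qed.

Lemma fg_lift_unique (h : free_group -> G) :
  {morph h : x y / x * y} -> (forall t, h (fg_gen t) = f t) -> h =1 fg_lift.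
Proof.
move=> hM hf.
have h1 : h 1 = 1 by apply: (mulgI (h 1)); rewrite -hM !mulg1.
have hV x : h x^-1 = (h x)^-1.
  by apply: (mulgI (h x)); rewrite -hM !mulgV h1.
case=> w rw; elim: w rw => [|l w IH] rw.
  rewrite /fg_lift big_nil -h1; congr h; exact: val_inj.
have rw' : reduced w by exact: path_sorted rw.
have E : FreeGroup rw =
    (if l.2 then (fg_gen l.1)^-1 else fg_gen l.1) * FreeGroup rw'.
  apply: val_inj => /=; case: l rw => t [] /=;
    by case: w rw' {IH} => //= m w _ /andP[/negPf ->].
rewrite {1}E hM IH /fg_lift /= big_cons; congr (_ * _).
by rewrite /letter_val; case: l.2; rewrite ?hV hf.
Qed.

End Universal.

Lemma size_word_mul u v : (size (word_mul u v) <= size u + size v)%N.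
Proof.
elim: u => //= l u; case: (word_mul u v) => [|m w] //=.
by case: ifP => // _ mw; rewrite ltnW // ltnW.
Qed.

Lemma size_word_inv u : size (word_inv u) = size u.
Proof. by rewrite size_rev size_map. Qed.

End FreeGroup.

Definition F2 : groupType := free_group 'I_2.

Section BoundedPacking.
Local Open Scope group_scope.
Variables (R : realType) (G : groupType).
Implicit Types (d : G -> G -> R) (H K S A B : set G).

Definition is_subgroup H := group_closed [in H].

Definition generated_subgroup S : set G := smallest is_subgroup S.

Definition finitely_generated H :=
  exists2 S, finite_set S & H = generated_subgroup S.

Record proper_left_invariant_metric d : Prop := {
  metric_eq0 : forall x y, d x y = 0%R <-> x = y;
  metric_sym : forall x y, d x y = d y x;
  metric_triangle : forall x y z, (d x z <= d x y + d y z)%R;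
  metric_left_invariant : forall g x y, d (g * x) (g * y) = d x y;
  metric_proper : forall x r, finite_set [set y | (d x y <= r)%R] }.

Definition set_dist d A B : R := inf [set d a b | a in A & b in B].

Definition left_cosets H : set (set G) :=
  [set [set g * h | h in H] | g in [set: G]].

Definition bounded_packing d H :=
  forall D : R, (0 < D)%R -> exists n : nat,
  forall I : set (set G), I `<=` left_cosets H ->
    (forall A B, I A -> I B -> (set_dist d A B <= D)%R) ->
    (I #<= `I_n)%card.

End BoundedPacking.

Section WordMetric.
Local Open Scope group_scope.
Variable R : realType.

Definition F2xF2_length (x : F2 * F2) := (size (word x.1) + size (word x.2))%N.

Definition F2xF2_dist (x y : F2 * F2) : R := (F2xF2_length (x^-1 * y)%g)%:R%R.

Lemma F2_ball_finite n : finite_set [set x : F2 | (size (word x) <= n)%N].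
Proof.
pose X := {i : 'I_n.+1 & i.-tuple (letter 'I_2)}.
pose g (p : X) : F2 := insubd (1 : F2) (val (tagged p)).
apply: (@sub_finite_set _ _ (g @` [set: X])).
  move=> x /= xn; exists (existT (fun i : 'I_n.+1 => i.-tuple _)
    (Ordinal (n:=n.+1) (m:=size (word x)) xn) (in_tuple (word x))) => //.
  by apply: val_inj; rewrite val_insubd /=; case: x xn => w /= ->.
exact/finite_image/finite_finset.
Qed.

(* Proper left-invariant metrics on F2 x F2 exist: the word metric is one. *)
Lemma F2xF2_dist_proper : proper_left_invariant_metric F2xF2_dist.
Proof.
have dV x : F2xF2_length x^-1 = F2xF2_length x.
  by rewrite /F2xF2_length /= !size_word_inv.
split.
- move=> x y; split=> [|->]; last by rewrite /F2xF2_dist mulVg.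
  move=> /eqP; rewrite /F2xF2_dist pnatr_eq0 addn_eq0 => /andP[/nilP e1 /nilP e2].
  suff : x^-1 * y = 1 by move/mulg1_eq; rewrite invgK.
  by apply/pair_equal_spec; split; apply: val_inj.
- by move=> x y; rewrite /F2xF2_dist -dV invgM invgK.
- move=> x y z; rewrite /F2xF2_dist -natrD ler_nat.
  have -> : x^-1 * z = (x^-1 * y) * (y^-1 * z) by rewrite mulgA mulgK.
  by rewrite /F2xF2_length addnACA leq_add // size_word_mul.
- by move=> g x y; rewrite /F2xF2_dist invgM mulgA mulgVK.
- move=> x r.
  have [n rn] : exists n, (r <= n%:R)%R.
    exists (Num.bound `|r|%R).
    by apply: le_trans (ler_norm r) (ltW (archi_boundP _)).
  pose B := [set a : F2 | (size (word a) <= n)%N].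
  apply: (@sub_finite_set _ _ ((fun z => x * z) @` (B `*` B))).
    move=> y /= yr; exists (x^-1 * y); last exact: mulVKg.
    have := le_trans yr rn; rewrite /F2xF2_dist ler_nat => h.
    by split; apply: leq_trans h; rewrite ?leq_addr ?leq_addl.
  by apply: finite_image; apply: finite_setX; exact: F2_ball_finite.
Qed.

End WordMetric.

(* Main.v *)
Require Import Defs.
From mathcomp Require Import all_boot all_order all_algebra.
From mathcomp Require Import all_classical all_reals.
From mathcomp Require Import lra.

(** Let N be the kernel of a surjection from F2 onto a finitely presented group
    Q, and let H be the fibre product of pairs (x, y) with x = y modulo N. It is
    generated by the diagonal generators together with one pair (u, v) for each
    defining relation u = v of Q. The cosets of H are represented by the elements
    (x, 1), and those of (x, 1) and (y, 1) are at distance at most d(1, (c, 1))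
    as soon as x^-1 y is conjugate to c in Q. So it suffices to find a finitely
    presented Q with an infinite sequence of distinct elements x_n whose
    quotients x_n^-1 x_m, for n < m, are all conjugate to one element c.

    Thompson's group F is such a group. It has generators x_0, x_1, ... and
    relations x_j ^ x_i = x_(j+1) for i < j; two of these relations, on the
    generators a and b = x_0 with x_n = b ^ (a^n), imply all the others
    ([thompson_rel]). In the usual numbering of the generators of F, a comes first
    and the element called x_n here is the one of index n + 1. Conjugating
    x_i^-1 x_j by x_i gives x_i^-1 x_(j+1), so x_i^-1 x_j is conjugate to
    x_i^-1 x_(i+1), which a power of a conjugates to c = x_0^-1 x_1
    ([thompson_quotient_conj]). That the x_n stay distinct in Q is seen on the
    action of F by piecewise linear homeomorphisms of the rational line, where
    x_n fixes exactly the points up to n ([pl_act_thompson_neq]).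

    The relation H (x, y) is used throughout as the congruence x = y modulo N. *)

Set Implicit Arguments.
Unset Strict Implicit.
Unset Printing Implicit Defensive.
Import Order.TTheory GRing.Theory Num.Theory.
Local Open Scope group_scope.
Local Open Scope classical_set_scope.

(** * Subgroups and generation *)

Section Subgroups.
Variables (G : groupType) (H : set G).

Lemma is_subgroupP :
  is_subgroup H <-> H 1 /\ forall x y, H x -> H y -> H (x * y^-1).
Proof.
split=> -[H1 HD]; split.
- by move: H1; rewrite in_setE.
- by move=> x y /mem_set Hx /mem_set Hy; apply: set_mem; exact: HD.
- by rewrite in_setE.
- by move=> x y; rewrite !in_setE; exact: HD.
Qed.

Hypothesis subH : is_subgroup H.

Lemma subgroup1 : H 1.
Proof. by case/is_subgroupP: subH. Qed.

Lemma subgroupV x : H x -> H x^-1.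
Proof.
by case/is_subgroupP: subH => H1 HD Hx; rewrite -[x^-1]mul1g; exact: HD.
Qed.

Lemma subgroupM x y : H x -> H y -> H (x * y).
Proof.
case/is_subgroupP: subH => _ HD Hx Hy; rewrite -[y]invgK.
by apply: HD => //; exact: subgroupV.
Qed.

End Subgroups.

Section Generated.
Variables (G : groupType) (S : set G).

Lemma generated_is_subgroup : is_subgroup (generated_subgroup S).
Proof.
apply/is_subgroupP; split=> [A [/= subA _]|x y Sx Sy A [/= subA SA]].
  exact: subgroup1.
by apply: subgroupM => //; [exact: Sx | apply: subgroupV => //; exact: Sy].
Qed.

Lemma sub_generated : S `<=` generated_subgroup S.
Proof. by move=> x Sx A [_]; exact. Qed.

Lemma generated_min (K : set G) :
  is_subgroup K -> S `<=` K -> generated_subgroup S `<=` K.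
Proof. by move=> subK SK x; apply. Qed.

End Generated.

(** * A criterion for the failure of bounded packing *)

Section Packing.
Variables (R : realType) (G : groupType) (d : G -> G -> R) (H : set G).
Hypotheses (dP : proper_left_invariant_metric d) (subH : is_subgroup H).

Lemma metric_ge0 x y : (0 <= d x y)%R.
Proof.
have := metric_triangle dP x y x.
rewrite (metric_sym dP y x) (metric_eq0 dP x x).2 //; lra.
Qed.

Lemma set_dist_sym A B : set_dist d A B = set_dist d B A.
Proof.
congr inf; apply/seteqP; split=> r [x Ax [y By <-]]; exists y => //;
  by exists x => //; rewrite (metric_sym dP).
Qed.

Lemma set_dist_le (A B : set G) x y : A x -> B y -> (set_dist d A B <= d x y)%R.
Proof.
move=> Ax By; apply: ge_inf; last by exists x => //; exists y.
by exists 0%R => r [u _ [v _ <-]]; exact: metric_ge0.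
Qed.

Let coset (g : G) : set G := [set (g * h)%g | h in H].

Lemma coset_inj_sub g g' : coset g = coset g' -> H (g^-1 * g').
Proof.
move=> E; have : coset g g' by rewrite E; exists 1; [exact: subgroup1|exact: mulg1].
by case=> h Hh <-; rewrite mulKg.
Qed.

Lemma set_dist_coset_le g g' h c k :
  H h -> H k -> g^-1 * g' = h * c * k ->
  (set_dist d (coset g) (coset g') <= d 1 c)%R.
Proof.
move=> Hh Hk E.
have -> : d 1 c = d (g * h) (g' * k^-1).
  have -> : g' = g * (h * c * k) by rewrite -E mulVKg.
  rewrite -(metric_left_invariant dP (g * h)) mulg1; congr d.
  by rewrite -!mulgA mulgV mulg1.
apply: set_dist_le; first by exists h.
by exists k^-1 => //; exact: subgroupV.
Qed.

(** Writing (g n)^-1 g m = h c k with h, k in H, the point g n h of the first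
    coset and the point g m k^-1 of the second differ by c; hence one bound
    d 1 c serves an infinite family of distinct cosets. *)
Lemma not_bounded_packing_double_coset (g : nat -> G) (c : G) :
  (forall n m, (n < m)%N -> ~ H ((g n)^-1 * g m)) ->
  (forall n m, (n < m)%N ->
     exists h k, [/\ H h, H k & (g n)^-1 * g m = h * c * k]) ->
  ~ bounded_packing d H.
Proof.
move=> gN gE /(_ (d 1 c + 1)%R).
have D0 := metric_ge0 1 c.
have Dgt0 : (0 < d 1 c + 1)%R by lra.
case=> // n /(_ [set coset (g i) | i in [set: nat]]) cI.
have lt_case p q : (p < q)%N ->
    (set_dist d (coset (g p)) (coset (g q)) <= d 1 c + 1)%R.
  move=> /gE[h [k [Hh Hk E]]].
  by apply: le_trans (set_dist_coset_le Hh Hk E) _; lra.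
have refl_case p : (set_dist d (coset (g p)) (coset (g p)) <= d 1 c + 1)%R.
  have H1 := subgroup1 subH.
  apply: le_trans (set_dist_coset_le (c := 1) H1 H1 _) _.
    by rewrite mulVg !mulg1.
  by rewrite (metric_eq0 dP 1 1).2 //; lra.
have ginj p q : coset (g p) = coset (g q) -> p = q.
  case: (ltngtP p q) => // pq E; first by case: (gN _ _ pq); exact: coset_inj_sub.
  by case: (gN _ _ pq); apply: coset_inj_sub; rewrite E.
apply: infinite_nat; apply: card_le_finite (finite_II n).
rewrite -(card_le_eql (inj_card_eq (in2W ginj))); apply: cI => [_ [i _ <-]|].
  by exists (g i).
move=> _ _ [i _ <-] [j _ <-].
by case: (ltngtP i j) => [/lt_case //|/lt_case|-> //]; rewrite set_dist_sym.
Qed.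

End Packing.

(** * Subgroups containing the diagonal are congruences *)

Section Congruence.
Variables (G : groupType) (H : set (G * G)).
Hypotheses (subH : is_subgroup H) (diagH : forall x, H (x, x)).

Lemma cong_trans x y z : H (x, y) -> H (y, z) -> H (x, z).
Proof.
move=> xy yz; have : H (x * (y^-1 * y), y * (y^-1 * z)) :=
  subgroupM subH xy (subgroupM subH (diagH y^-1) yz).
by rewrite mulVg mulg1 mulVKg.
Qed.

Lemma cong_sym x y : H (x, y) -> H (y, x).
Proof.
move=> /(subgroupV subH) xy.
have : H (y * (x^-1 * x), y * (y^-1 * x)) :=
  subgroupM subH (diagH y) (subgroupM subH xy (diagH x)).
by rewrite mulVg mulg1 mulVKg.
Qed.

Lemma congM x x' y y' : H (x, x') -> H (y, y') -> H (x * y, x' * y').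
Proof. exact: (subgroupM subH). Qed.

Lemma congJ x x' y y' : H (x, x') -> H (y, y') -> H (x ^ y, x' ^ y').
Proof.
move=> xx yy; apply: congM; last exact: congM.
exact: (subgroupV subH yy).
Qed.

(** Conjugation by u in the quotient becomes multiplication by diagonal pairs on
    both sides, which do not leave the double coset of (c, 1). *)
Lemma double_coset_of_conj x c u :
  H (x, c ^ u) -> exists h k, [/\ H h, H k & (x, 1) = h * (c, 1) * k].
Proof.
move=> xc; exists (u^-1, u^-1), (c^-1 * u * x, u); split.
- exact: diagH.
- have uE : c^-1 * u * c ^ u = u by rewrite conjgE -!mulgA mulVKg mulKg.
  by have := congM (diagH (c^-1 * u)) xc; rewrite uE.
- change ((x, 1) = (u^-1 * c * (c^-1 * u * x), u^-1 * 1 * u)).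
  by rewrite mulg1 mulVg -!mulgA mulVKg mulKg.
Qed.

End Congruence.

(** * Thompson's group F *)

Section Thompson.
Variables (G : groupType) (a b : G).

Definition thompson n := b ^ (a ^+ n).

Lemma thompson_shift n k : thompson n ^ (a ^+ k) = thompson (n + k).
Proof. by rewrite /thompson -conjgM -expgnDr. Qed.

Variable H : set (G * G).
Hypotheses (subH : is_subgroup H) (diagH : forall x, H (x, x)).
Hypotheses (rel1 : H (thompson 1 ^ thompson 0, thompson 2))
           (rel2 : H (thompson 2 ^ thompson 0, thompson 3)).

(** Let j = n + 1. For j > 2, smaller cases shifted by a and by a^2 say that
    x_j = x_(j-1) ^ x_1 and x_j ^ x_2 = x_(j+1). Conjugating the former by x_0
    gives x_j ^ x_0 = (x_(j-1) ^ x_0) ^ (x_1 ^ x_0) = x_j ^ x_2, which is x_(j+1).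
    For j = 1 and j = 2 there are no such smaller cases, whence the two defining
    relations. *)
Lemma thompson_rel0 n : H (thompson n.+1 ^ thompson 0, thompson n.+2).
Proof.
have shift k p q r : H (thompson p ^ thompson q, thompson r) ->
    H (thompson (p + k) ^ thompson (q + k), thompson (r + k)).
  by rewrite -!thompson_shift -conjJg => E; exact: congJ.
elim/ltn_ind: n => -[|[|n]] IH //.
have E1 : H (thompson n.+2 ^ thompson 1, thompson n.+3).
  by have := shift 1%N _ _ _ (IH n (leqW (leqnn _))); rewrite !addn1.
have E2 : H (thompson n.+3 ^ thompson 2, thompson n.+4).
  by have := shift 2%N _ _ _ (IH n (leqW (leqnn _))); rewrite !addn2.
apply: (cong_trans subH diagH) (congJ subH (cong_sym subH diagH E1) (diagH _)) _.
rewrite conjJg; apply: (cong_trans subH diagH) _ E2.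
exact: congJ (IH n.+1 (leqnn _)) rel1.
Qed.

Lemma thompson_rel i m :
  H (thompson (i + m.+1) ^ thompson i, thompson (i + m.+2)).
Proof.
rewrite ![(i + _)%N]addnC -[X in _ ^ thompson X]add0n -!thompson_shift -conjJg.
exact: congJ (thompson_rel0 m) (diagH _).
Qed.

(** Conjugating x_i^-1 x_j by x_i raises j by one, because x_i commutes with
    x_i^-1 and maps x_j to x_(j+1). *)
Lemma thompson_quotient_conj i m :
  H ((thompson i)^-1 * thompson (i + m.+1),
     ((thompson 0)^-1 * thompson 1) ^ (a ^+ i * thompson i ^+ m)).
Proof.
elim: m => [|m IH].
  rewrite mulg1 conjMg conjVg !thompson_shift add0n addnC; exact: diagH.
rewrite expgSr (mulgA (a ^+ i)) [X in (_, X)]conjgM.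
apply: (cong_trans subH diagH _ (congJ subH IH (diagH (thompson i)))).
have -> : ((thompson i)^-1 * thompson (i + m.+1)) ^ thompson i =
    (thompson i)^-1 * thompson (i + m.+1) ^ thompson i.
  by rewrite conjMg conjVg [X in X^-1 * _]conjgE mulKg.
exact: congM (diagH _) (cong_sym subH diagH (thompson_rel i m)).
Qed.

End Thompson.

(** * Free groups: the diagonal and actions *)

Lemma diag_sub_of_gen (T : choiceType) (H : set (free_group T * free_group T)) :
  is_subgroup H -> (forall t, H (fg_gen t, fg_gen t)) -> forall x, H (x, x).
Proof.
move=> subH Hgen x.
rewrite (_ : x = fg_lift (@fg_gen T) x); last exact: (@fg_lift_unique T _ _ id).
rewrite /fg_lift; apply: (big_ind (fun y => H (y, y))).
- exact: (subgroup1 subH).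
- by move=> y z Hy Hz; exact: (subgroupM subH Hy Hz).
- move=> [t c] _; rewrite /letter_val; case: c => //=.
  exact: (subgroupV subH (Hgen t)).
Qed.

Section WordAction.
Variables (T : choiceType) (X : Type) (f : letter T -> X -> X).
Hypothesis fK : forall l, cancel (f (letter_inv l)) (f l).

Definition word_act (x : free_group T) : X -> X := fun t => foldr f t (word x).

Lemma word_actM x y t : word_act (x * y) t = word_act x (word_act y t).
Proof.
rewrite /word_act [word (x * y)]/=; elim: (word x) => //= l u <-.
case: (word_mul u _) => //= m w.
by case: eqP => [->|//]; rewrite fK.
Qed.

Lemma word_actKV x : cancel (word_act x) (word_act x^-1).
Proof. by move=> t; rewrite -word_actM mulVg. Qed.

Lemma word_act_conj x y t :
  word_act (x ^ y) t = word_act y^-1 (word_act x (word_act y t)).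
Proof. by rewrite conjgE !word_actM. Qed.

(** A subgroup of the square of the free group that is generated by pairs acting
    alike contains only such pairs: this is how non-membership is proved. *)
Lemma word_act_fibre_subgroup :
  is_subgroup
    [set p : free_group T * free_group T | word_act p.1 = word_act p.2].
Proof.
apply/is_subgroupP; split=> // -[x x'] [y y'] /= xE yE; apply/funext => t.
have -> : t = word_act y (word_act y^-1 t) by rewrite -word_actM mulgV.
by rewrite !word_actM xE word_actKV yE word_actKV.
Qed.

End WordAction.

(** * The piecewise linear action of F *)

Section PiecewiseLinear.
Local Open Scope ring_scope.

Definition stretch (t : rat) : rat :=
  if t <= 0 then t else if t <= 1 then 2 * t else t + 1.
Definition shrink (t : rat) : rat :=
  if t <= 0 then t else if t <= 2 then t / 2 else t - 1.

Lemma stretchK : cancel stretch shrink.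
Proof. by move=> t; rewrite /stretch /shrink; repeat case: ifP; lra. Qed.

Lemma shrinkK : cancel shrink stretch.
Proof. by move=> t; rewrite /stretch /shrink; repeat case: ifP; lra. Qed.

(** Generator 0 translates by -1, so that conjugating by its n-th power moves the
    half-line of points that [shrink] displaces from 0 to n. *)
Definition pl_letter (l : letter 'I_2) : rat -> rat :=
  match l.1 == ord0, l.2 with
  | true, false => fun t => t - 1
  | true, true => fun t => t + 1
  | false, false => shrink
  | false, true => stretch
  end.

Lemma pl_letterK l : cancel (pl_letter (letter_inv l)) (pl_letter l).
Proof.
case: l => i b; rewrite /pl_letter /=; case: (i == ord0); case: b => /= t;
  by rewrite ?stretchK ?shrinkK ?subrK ?addrK.
Qed.

End PiecewiseLinear.

Definition gen_a : F2 := fg_gen ord0.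
Definition gen_b : F2 := fg_gen ord_max.
Definition pl_act : F2 -> rat -> rat := word_act pl_letter.
Local Notation x_ := (thompson gen_a gen_b).

Lemma pl_act_thompson n t :
  pl_act (x_ n) t = (shrink (t - n%:R) + n%:R)%R.
Proof.
have aE m u : pl_act (gen_a ^+ m) u = (u - m%:R)%R.
  elim: m u => [|m IH] u; first by rewrite subr0.
  rewrite expgS [LHS](word_actM pl_letterK) -[word_act _ _ u]/(pl_act _ u) IH.
  by rewrite -natr1 opprD addrA.
have aVE m u : pl_act (gen_a ^+ m)^-1 u = (u + m%:R)%R.
  have uE : u = pl_act (gen_a ^+ m) (u + m%:R)%R by rewrite aE addrK.
  rewrite [in LHS]uE; exact: word_actKV pl_letterK _ _.
by rewrite [LHS](word_act_conj pl_letterK) [LHS]aVE -(aE n t).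
Qed.

(** Beyond 2, x_0 is the translation by -1, and this contains the points that
    x_(n+2) displaces; so it conjugates x_(n+1) to x_(n+2). *)
Lemma pl_act_thompson_rel0 n :
  pl_act (x_ n.+1 ^ x_ 0) = pl_act (x_ n.+2).
Proof.
apply/funext => t; rewrite [LHS](word_act_conj pl_letterK).
apply: (can_inj (word_actKV pl_letterK (x_ 0))).
rewrite -[LHS](word_actM pl_letterK) mulgV.
rewrite -[LHS]/(pl_act (x_ n.+1) (pl_act (x_ 0) t)) -/pl_act.
rewrite !pl_act_thompson subr0 addr0.
have -> : (n.+2%:R = n%:R + 2 :> rat)%R by rewrite -addn2 natrD.
have -> : (n.+1%:R = n%:R + 1 :> rat)%R by rewrite -addn1 natrD.
have := ler0n rat n; move: (n%:R)%R => q q0.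
by rewrite /shrink; repeat case: ifP; lra.
Qed.

Lemma pl_act_thompson_neq n m : (n < m)%N -> pl_act (x_ n) <> pl_act (x_ m).
Proof.
(* The point n + 1 is moved by x_n to n + 1/2, but fixed by x_m. *)
move=> nm /(congr1 (fun h => h (n%:R + 1)%R)); rewrite !pl_act_thompson.
have : (n%:R + 1 <= m%:R :> rat)%R by rewrite natr1 ler_nat.
move: (n%:R)%R (m%:R)%R => p q pq.
by rewrite /shrink; repeat case: ifP; lra.
Qed.

(** * The fibre product over F *)

Definition thompson_fibre_gens : seq (F2 * F2) :=
  [:: (gen_a, gen_a); (gen_b, gen_b);
      (x_ 1 ^ x_ 0, x_ 2); (x_ 2 ^ x_ 0, x_ 3)].

Definition thompson_fibre : set (F2 * F2) :=
  generated_subgroup [set` thompson_fibre_gens].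

Lemma thompson_fibre_subgroup : is_subgroup thompson_fibre.
Proof. exact: generated_is_subgroup. Qed.

Lemma thompson_fibre_gen p : p \in thompson_fibre_gens -> thompson_fibre p.
Proof. by move=> pS; exact: sub_generated. Qed.

Lemma thompson_fibre_diag x : thompson_fibre (x, x).
Proof.
apply: diag_sub_of_gen thompson_fibre_subgroup _ x => -[[|[|//]] i2].
- rewrite (_ : Ordinal i2 = ord0); last exact: val_inj.
  by apply: thompson_fibre_gen; rewrite mem_head.
- rewrite (_ : Ordinal i2 = ord_max); last exact: val_inj.
  by apply: thompson_fibre_gen; rewrite !inE eqxx orbT.
Qed.

Lemma thompson_fibre_act x y : thompson_fibre (x, y) -> pl_act x = pl_act y.
Proof.
move/(generated_min (word_act_fibre_subgroup pl_letterK)); apply => -[{}x {}y].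
rewrite /= !inE => /or4P[] /eqP[-> ->] //; exact: pl_act_thompson_rel0.
Qed.

Theorem proposition5p1 (R : realType) :
  exists H : set (F2 * F2)%type,
    finitely_generated H /\
    forall d : (F2 * F2)%type -> (F2 * F2)%type -> R,
      proper_left_invariant_metric d -> ~ bounded_packing d H.
Proof.
exists thompson_fibre; split.
  by exists [set` thompson_fibre_gens]; [exact: finite_seq|].
have subH := thompson_fibre_subgroup; have diagH := thompson_fibre_diag.
move=> d dP; pose c := (x_ 0)^-1 * x_ 1.
apply: (not_bounded_packing_double_coset dP subH (g := fun n => (x_ n, 1))
  (c := (c, 1))) => n m nm.
- have -> : (x_ n, 1)^-1 * (x_ m, 1) = ((x_ n)^-1 * x_ m, 1^-1 * 1) by [].
  rewrite mulVg => /(congM subH (diagH (x_ n))).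
  rewrite mulVKg mulg1 => /thompson_fibre_act E.
  exact: (pl_act_thompson_neq nm).
- have -> : (x_ n, 1)^-1 * (x_ m, 1) = ((x_ n)^-1 * x_ m, 1^-1 * 1) by [].
  rewrite mulVg -(subnKC nm) addSnnS.
  apply: (double_coset_of_conj subH diagH).
  by apply: thompson_quotient_conj => //; apply: thompson_fibre_gen;
    rewrite !inE eqxx !orbT.
Qed.
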